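(* Let $A$ be the canonical model of the $A_\infty$-algebra of the Clifford torus $L=T^2\subset\mathbb{C}P^2$ over the Novikov field $\Lambda$, with $m_0$ replaced by $0$ (described in the context), with basis $e,f_1,f_2,f_{12}$. Then $$\alpha:=N_3(f_1\otimes f_1\otimes f_{12})+3\,N_3(f_2\otimes f_2\otimes f_{12})+3\,N_3(e\otimes f_1\otimes f_2)\,T$$ is a non-trivial cyclic cohomology cycle of $A$: it is a cyclically invariant element with $\widehat d\,\alpha=0$ and its class in the homology of $((C_\bullet(A,A))^{cyc},\widehat d)$ is non-zero. Moreover the value of $m^+$ on $\alpha$ is $m^+(\alpha)=18\,T$.
   Context: **Coefficients.** $\Lambda$ is the Novikov field of formal sums $\sum_ia_iT^{\lambda_i}$, $\lambda_i\in\mathbb{R}$, $\lambda_i\to\infty$, with coefficients in a field of characteristic $0$ containing $\sqrt2$ (e.g. $\mathbb{R}$ or $\mathbb{C}$); the grading is taken modulo $2$. $|x|'=|x|-1$ is the shifted degree. **The algebra.** $L$ is identified with $\mathbb{R}^2/\mathbb{Z}^2$ with coordinates $(x,y)$, $e_1=dx$, $e_2=dy$. The operations come from $m_{k,\beta}(\rho_1,\dots,\rho_k)=(ev_0)_!(ev_1,\dots,ev_k)^*(\rho_1\wedge\cdots\wedge\rho_k)$ on differential forms, for moduli spaces of holomorphic discs with boundary on $L$, and are transferred to the canonical model on the harmonic forms. $\beta_0,\beta_1,\beta_2$ are the Maslov index $2$ disc classes $[z;1;1],[1;z;1],[1;1;z]$, each of symplectic area $1$, and the pairings $(\partial\beta_j\cap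 e_i)$ of their boundaries with $(e_1,e_2)$ are $(-1,-1)$, $(1,0)$, $(0,1)$ for $j=0,1,2$. The facts about $A$ used are the following. $A$ has basis $e$ (degree $0$), $f_1=\frac{e_1+e_2}{\sqrt2}$, $f_2=\frac{e_1-e_2}{\sqrt2}$ (degree $1$), and $f_{12}:=m_2(f_1,f_2)$ (degree $2$). The maps $m_k:A[1]^{\otimes k}\to A[1]$, $k\ge0$, have degree $1$, with $m_0=0$ (after replacement), $m_1=0$, and satisfy the $A_\infty$-equations $\widehat d\circ\widehat d=0$, where $\widehat d=\sum_k\widehat m_k$ and $$\widehat m_k(x_1\otimes\cdots\otimes x_n)=\sum_{i=1}^{n-k+1}(-1)^{|x_1|'+\cdots+|x_{i-1}|'}x_1\otimes\cdots\otimes m_k(x_i,\dots,x_{i+k-1})\otimes\cdots\otimes x_n$$ (zero if $k>n$). The element $e$ is a strict unit: $m_2(e,x)=(-1)^{|x|}m_2(x,e)=x$, and $m_k(\dots,e,\dots)=0$ for $k\ne2$. One has $$m_2(f_1,f_1)=\tfrac32T\,e,\quad m_2(f_2,f_2)=\tfrac12T\,e,\quad m_2(f_1,f_2)=f_{12},\quad m_2(f_2,f_1)=-f_{12},$$ $$m_3(f_{i_1},f_{i_2},f_{i_3})=\tfrac1{3!}\sum_{j=0}^{2}\ \prod_{s=1}^3(\partial\beta_j\cap f_{i_s})\,T\,e.$$ $A$ is cyclic with respect to a non-degenerate graded skew-symmetric pairing ($\langle a,b\rangle=-(-1)^{|a|'|b|'}\langle b,a\rangle$), $\langle m_k(x_1,\dots,x_k),x_{k+1}\rangle=(-1)^{|x_1|'(|x_2|'+\cdots+|x_{k+1}|')}\langle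 m_k(x_2,\dots,x_{k+1}),x_1\rangle$, with $\langle f_1,f_2\rangle=-\langle f_2,f_1\rangle=1$ and hence $\langle f_{12},e\rangle=\langle e,f_{12}\rangle=1$. **Cyclic complex and $m^+$.** $t_{n+1}(x_0,\dots,x_n)=(-1)^{|x_n|'(|x_0|'+\cdots+|x_{n-1}|')}(x_n,x_0,\dots,x_{n-1})$ and $N_{n+1}=1+t_{n+1}+\cdots+t_{n+1}^n$. $C_\bullet(A,A)$ is the energy-completion of $\bigoplus_{k\ge0}A[1]\otimes A[1]^{\otimes k}$, and $(C_\bullet(A,A))^{cyc}$ is its subspace of elements invariant under the cyclic actions $t_{n+1}$, with differential $\widehat d$. $m^+$ is defined linearly by $m^+(x_1\otimes\cdots\otimes x_k)=\langle m_{k-1}(x_1,\dots,x_{k-1}),x_k\rangle$, and $m^+(\alpha)$ is the evaluation of this linear function on the tensor $\alpha$ (all terms of the symmetrizations included). *)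

(* Defs.v *)
From HB Require Import structures.
From mathcomp Require Import all_boot all_order all_algebra.
From mathcomp Require Import all_classical all_reals.

Set Implicit Arguments.
Unset Strict Implicit.
Unset Printing Implicit Defensive.
Import Order.TTheory GRing.Theory Num.Theory.
Local Open Scope classical_set_scope.
Local Open Scope ring_scope.

(** A formal sum [\sum_i a_i T^(l_i)] with [l_i --> +oo] is encoded by its
    coefficient function: only finitely many exponents below any given energy
    carry a nonzero coefficient. *)

Definition locally_finite (R : realType) (K : fieldType) (a : R -> K) : Prop :=
  forall E : R, finite_set [set l | l <= E /\ a l != 0].

Record novikov (R : realType) (K : fieldType) := Novikov {
  nov_coef :> R -> K;
  novP : locally_finite nov_coef }.

HB.instance Definition _ (R : realType) (K : fieldType) :=
  gen_eqMixin (novikov R K).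
HB.instance Definition _ (R : realType) (K : fieldType) :=
  gen_choiceMixin (novikov R K).

Section NovikovRing.
Variables (R : realType) (K : fieldType).
Implicit Types (a b c : novikov R K) (l m E : R).

Lemma nov_ext a b : (forall l, a l = b l) -> a = b.
Proof.
case: a b => [a aP] [b bP] /= ab; have {}ab : a = b by apply/funext.
by subst b; congr Novikov; apply: Prop_irrelevance.
Qed.

Lemma locally_finite0 : locally_finite (fun _ : R => 0 : K).
Proof.
by move=> E; apply: (sub_finite_set (B := set0)) => // l /= [_]; rewrite eqxx.
Qed.

Lemma locally_finiteN a : locally_finite (fun l => - a l).
Proof.
by move=> E; apply: sub_finite_set (novP a E) => l /= [-> +]; rewrite oppr_eq0.
Qed.

Lemma locally_finiteD a b : locally_finite (fun l => a l + b l).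
Proof.
move=> E; have := conj (novP a E) (novP b E).
rewrite -finite_setU; apply: sub_finite_set => l /= [lE].
have [al|] := eqVneq (a l) 0; last by left.
by rewrite al add0r; right.
Qed.

Definition nov0 := Novikov locally_finite0.
Definition novN a := Novikov (locally_finiteN a).
Definition novD a b := Novikov (locally_finiteD a b).

Fact novDA : associative novD.
Proof. by move=> a b c; apply: nov_ext => l; apply: addrA. Qed.
Fact novDC : commutative novD.
Proof. by move=> a b; apply: nov_ext => l; apply: addrC. Qed.
Fact nov0D : left_id nov0 novD.
Proof. by move=> a; apply: nov_ext => l; apply: add0r. Qed.
Fact novND : left_inverse nov0 novN novD.
Proof. by move=> a; apply: nov_ext => l; apply: addNr. Qed.

HB.instance Definition _ :=
  GRing.isZmodule.Build (novikov R K) novDA novDC nov0D novND.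

Lemma nov_coef0 l : (0 : novikov R K) l = 0. Proof. by []. Qed.
Lemma nov_coefD a b l : (a + b) l = a l + b l. Proof. by []. Qed.
Lemma nov_coefN a l : (- a) l = - a l. Proof. by []. Qed.
Lemma nov_coefB a b l : (a - b) l = a l - b l. Proof. by []. Qed.

Lemma seq_lb (s : seq R) : exists2 x, x <= 0 & {in s, forall y, x <= y}.
Proof.
elim: s => [|y s [x x0 xs]]; first by exists 0.
exists (Num.min x y); first by rewrite ge_min x0.
move=> z; rewrite inE ge_min => /orP[/eqP ->|/xs ->] //.
by rewrite lexx orbT.
Qed.

Lemma nov_suppP a E :
  exists2 s : seq R, uniq s & forall l, l <= E -> a l != 0 -> l \in s.
Proof.
have /finite_seqP[s sE] := novP a E; exists (undup s); first exact: undup_uniq.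
move=> l lE al; rewrite mem_undup.
by have : [set` s] l by rewrite -sE.
Qed.

Lemma nov_lb a : exists x, forall l, a l != 0 -> x <= l.
Proof.
have [s _ sP] := nov_suppP a 0; have [x x0 xs] := seq_lb s.
exists x => l al; have [l0|/ltW l0] := leP l 0; first exact/xs/sP.
exact: le_trans l0.
Qed.

Definition conv a b l : K := \sum_(m \in [set: R]) a m * b (l - m).

Lemma conv_seq a b l (s : seq R) : uniq s ->
    (forall m, a m != 0 -> b (l - m) != 0 -> m \in s) ->
  conv a b l = \sum_(m <- s) a m * b (l - m).
Proof.
move=> us sP; rewrite fsbig_seq // /conv; apply/esym.
apply: fsbig_widen => // m /= [_ /negP]; apply: contraNeq.
by rewrite mulf_eq0 negb_or => /andP[]; apply: sP.
Qed.

Lemma conv_suppP a b l : exists2 s : seq R, uniq s &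
  forall m, a m != 0 -> b (l - m) != 0 -> m \in s.
Proof.
have [y yP] := nov_lb b; have [s us sP] := nov_suppP a (l - y).
by exists s => // m am /yP; rewrite lerBrDl -lerBrDr => /sP; apply.
Qed.

Lemma conv_neq0 a b l : conv a b l != 0 ->
  exists m, a m != 0 /\ b (l - m) != 0.
Proof.
apply: contraNP => /forallNP ab; apply/eqP/fsbig1 => m _; apply/eqP.
by rewrite mulf_eq0 -[_ || _]negbK negb_or; apply/andP/ab.
Qed.

Lemma locally_finite_conv a b : locally_finite (conv a b).
Proof.
move=> E; have [x xP] := nov_lb a; have [y yP] := nov_lb b.
have [s _ sP] := nov_suppP a (E - y); have [t _ tP] := nov_suppP b (E - x).
apply: sub_finite_set (finite_seq [seq m + n | m <- s, n <- t]).
move=> l /= [lE /conv_neq0[m [am bm]]]; apply/allpairsP.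
exists (m, l - m); rewrite /= subrKC; split=> //.
- apply: sP => //; rewrite lerBrDr addrC; apply: le_trans lE.
  by rewrite -lerBrDr yP.
- by apply: tP => //; apply: lerB => //; apply: xP.
Qed.

Definition novM a b := Novikov (@locally_finite_conv a b).

Lemma locally_finite_mono (c : K) l :
  locally_finite (fun m => if m == l then c else 0).
Proof.
move=> E; apply: (sub_finite_set (B := [set l])); last exact: finite_set1.
move=> m /= [_].
by case: ifP => [/eqP|]; rewrite ?eqxx.
Qed.

(* [c T^l] *)
Definition nov_mono (c : K) l := Novikov (@locally_finite_mono c l).

Lemma nov_coef_mono (c : K) l m : nov_mono c l m = if m == l then c else 0.
Proof. by []. Qed.

Lemma conv_mono (c : K) l b m : conv (nov_mono c l) b m = c * b (m - l).
Proof.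
rewrite (@conv_seq _ _ _ [:: l]) ?big_seq1 //= ?eqxx // => n.
by case: ifP => [/eqP -> _ _|]; rewrite ?inE // eqxx.
Qed.

Fact novMC : commutative novM.
Proof.
move=> a b; apply: nov_ext => l /=; have [s us sP] := conv_suppP a b l.
rewrite (conv_seq us sP) (@conv_seq _ _ _ [seq l - m | m <- s]).
- by rewrite big_map; apply: eq_bigr => m _; rewrite subKr mulrC.
- by rewrite map_inj_uniq //; apply: can_inj (subKr l).
- move=> m bm am; rewrite -[m](subKr l); apply: (map_f (fun m => l - m)).
  by apply: sP; rewrite ?subKr.
Qed.

Fact novMA : associative novM.
Proof.
move=> a b c; apply: nov_ext => l /=.
have [x xP] := nov_lb a; have [y yP] := nov_lb b; have [z zP] := nov_lb c.
have conv_lb (d e : novikov R K) u v : (forall m, d m != 0 -> u <= m) ->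
    (forall m, e m != 0 -> v <= m) -> forall m, conv d e m != 0 -> u + v <= m.
  move=> ud ve m /conv_neq0[n [/ud un /ve]]; rewrite lerBrDl; apply: le_trans.
  by rewrite lerD2r.
have [s us sP] := nov_suppP a (l - z - y).
have [t ut tP] := nov_suppP c (l - x - y).
pose p := [seq l - m | m <- t].
have up : uniq p by rewrite map_inj_uniq //; apply: can_inj (subKr l).
have pP n : x + y <= n -> c (l - n) != 0 -> n \in p.
  move=> xyn cn; rewrite -[n](subKr l); apply: (map_f (fun m => l - m)).
  by apply: tP => //; rewrite -addrA -opprD lerD2l lerN2.
rewrite [LHS](@conv_seq a (novM b c) _ s) //; last first.
  move=> m am /(conv_lb _ _ _ _ yP zP) yz; apply: sP => //.
  by rewrite !lerBrDr -addrA -lerBrDl.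
rewrite [RHS](@conv_seq (novM a b) c _ p) //; last first.
  by move=> m /(conv_lb _ _ _ _ xP yP); apply: pP.
transitivity (\sum_(m <- s) \sum_(n <- p) a m * (b (n - m) * c (l - n))).
  apply: eq_bigr => m _; have [->|am] := eqVneq (a m) 0.
    by rewrite mul0r big1 // => n _; rewrite mul0r.
  rewrite -mulr_sumr; congr (_ * _) => /=.
  rewrite (@conv_seq b c _ [seq n - m | n <- p]).
  - rewrite big_map; apply: eq_bigr => n _; congr (_ * c _).
    by rewrite opprB addrA subrK.
  - by rewrite map_inj_uniq //; apply: addIr.
  - move=> n bn cn; rewrite -[n](addrK m).
    apply: (map_f (fun n => n - m)); apply: pP.
    + by rewrite addrC lerD ?xP ?yP.
    + by move: cn; rewrite opprD addrA addrAC.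
rewrite exchange_big; apply: eq_bigr => n _ /=.
have [->|cn] := eqVneq (c (l - n)) 0.
  by rewrite mulr0 big1 // => m _; rewrite !mulr0.
rewrite (@conv_seq a b _ s) ?mulr_suml //.
  by apply: eq_bigr => m _; rewrite mulrA.
move=> m am bm; apply: sP => //; have := yP _ bm; have := zP _ cn.
rewrite !lerBrDr => zn yn; apply: le_trans zn.
by rewrite [z + n]addrC lerD2r addrC.
Qed.

Definition nov1 := nov_mono 1 0.

Fact nov1M : left_id nov1 novM.
Proof. by move=> a; apply: nov_ext => l /=; rewrite conv_mono subr0 mul1r. Qed.

Fact novMDl : left_distributive novM novD.
Proof.
move=> a b c; apply: nov_ext => l /=.
have [s us sP] := conv_suppP a c l; have [t ut tP] := conv_suppP b c l.
have st m : (a m != 0) || (b m != 0) -> c (l - m) != 0 -> m \in undup (s ++ t).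
  rewrite mem_undup mem_cat => /orP[am|bm] cm; first by rewrite sP.
  by rewrite tP ?orbT.
rewrite !(@conv_seq _ _ _ (undup (s ++ t))) ?undup_uniq //.
- by rewrite -big_split; apply: eq_bigr => m _; rewrite mulrDl.
- by move=> m bm; apply: st; rewrite bm orbT.
- by move=> m am; apply: st; rewrite am.
- move=> m abm; apply: st; move: abm => /=.
  by have [->|//] := eqVneq (a m) 0; rewrite add0r.
Qed.

Fact nov1_neq0 : nov1 != nov0.
Proof.
apply/eqP => /(congr1 (fun a : novikov R K => a 0)) /=.
by rewrite eqxx; apply/eqP/oner_neq0.
Qed.

HB.instance Definition _ := GRing.Zmodule_isComNzRing.Build (novikov R K)
  novMA novMC nov1M novMDl nov1_neq0.

Lemma nov_coefM a b l :
  (a * b) l = \sum_(m \in [set: R]) a m * b (l - m).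
Proof. by []. Qed.

Lemma nov_coef_sum (I : Type) (r : seq I) (P : pred I) (F : I -> novikov R K) l :
  (\sum_(i <- r | P i) F i) l = \sum_(i <- r | P i) F i l.
Proof. exact: (big_morph (fun a : novikov R K => a l)). Qed.

Lemma nov_geom (u : novikov R K) (e : R) : 0 < e ->
  (forall l, u l != 0 -> e <= l) -> exists b, b * (1 - u) = 1.
Proof.
move=> e0 ue.
have uX n l : (u ^+ n) l != 0 -> e *+ n <= l.
  elim: n l => [|n IHn] l.
    by rewrite expr0 /= mulr0n; case: ifP => [/eqP ->|]; rewrite ?eqxx.
  rewrite exprS => /conv_neq0[m [/ue em /IHn]]; rewrite lerBrDl mulrS.
  by apply: le_trans; rewrite lerD2r.
pose N l := Num.bound (l / e).
have NP l n : (N l <= n)%N -> l < e *+ n.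
  move=> Nn; rewrite -mulr_natl -ltr_pdivrMr //.
  have [l0|l0] := leP 0 (l / e).
    by apply: lt_le_trans (archi_boundP l0) _; rewrite ler_nat.
  exact: lt_le_trans l0 _.
pose G n := \sum_(i < n) u ^+ i.
pose g l := G (N l) l.
have gG l n : l < e *+ n -> g l = G n l.
  have aux p q : (p <= q)%N -> l < e *+ p -> G p l = G q l.
    move=> pq lp; rewrite /G !nov_coef_sum.
    rewrite (big_ord_widen q (fun i => (u ^+ i) l)) // big_mkcond /=.
    apply: eq_bigr => i _; case: ltnP => // pi.
    apply/esym/eqP; apply: contraTT lp => /uX il; rewrite -leNgt.
    by apply: le_trans il; rewrite ler_wpMn2l // ltW.
  move=> ln; case: (leqP (N l) n) => [Nn|/ltnW nN].
    by apply: aux => //; apply: NP.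
  by apply/esym/aux.
have gP : locally_finite g.
  move=> E; apply: sub_finite_set (novP (G (N E)) E) => l /= [lE].
  by rewrite (@gG l (N E)) //; apply: le_lt_trans lE _; apply: NP.
have u1 m : (1 - u) m != 0 -> 0 <= m.
  apply: contraNT; rewrite -ltNge => m0; rewrite nov_coefB /=.
  rewrite lt_eqF // sub0r oppr_eq0; apply: contraTT m0 => /ue em.
  by rewrite -leNgt; apply: le_trans em; apply: ltW.
exists (Novikov gP); rewrite mulrC; apply: nov_ext => l.
transitivity (((1 - u) * G (N l)) l).
  rewrite !nov_coefM; apply: eq_fsbigr => m _.
  have [->|/u1 m0] := eqVneq ((1 - u) m) 0; first by rewrite !mul0r.
  congr (_ * _); rewrite /= (@gG _ (N l)) //.
  by apply: le_lt_trans (NP l _ (leqnn _)); rewrite gerBl.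
have -> : (1 - u) * G (N l) = 1 - u ^+ N l.
  by rewrite -opprB mulNr -subrX1 opprB.
rewrite nov_coefB; have [->|] := eqVneq ((u ^+ N l) l) 0; first by rewrite subr0.
by move=> /uX; rewrite leNgt NP.
Qed.

Lemma seq_min (s : seq R) : s != [::] ->
  exists2 x, x \in s & {in s, forall y, x <= y}.
Proof.
elim: s => // y [|z s] IHs _.
  by exists y; rewrite ?mem_head // => w; rewrite inE => /eqP ->.
have [x xs xP] := IHs isT; have [yx|/ltW xy] := leP y x.
  exists y; first exact: mem_head.
  by move=> w; rewrite inE => /orP[/eqP ->//|/xP]; apply: le_trans.
exists x; first by rewrite inE xs orbT.
by move=> w; rewrite inE => /orP[/eqP ->//|/xP].
Qed.

Lemma nov_min a (P : pred R) : (exists2 l, P l & a l != 0) ->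
  exists l, [/\ P l, a l != 0 & forall m, P m -> a m != 0 -> l <= m].
Proof.
move=> [l0 Pl0 al0]; have [s us sP] := nov_suppP a l0.
have ls : l0 \in [seq m <- s | P m && (a m != 0)].
  by rewrite mem_filter Pl0 al0 /= sP.
have /seq_min[x] : [seq m <- s | P m && (a m != 0)] != [::].
  by apply: contraTneq ls => ->.
rewrite mem_filter => /andP[/andP[Px ax] xs] xP.
exists x; split=> // m Pm am; have [ml|/ltW lm] := leP m l0.
  by apply: xP; rewrite mem_filter Pm am sP.
exact: le_trans (xP _ ls) lm.
Qed.

Lemma nov_has_inv a : a != 0 -> exists b, b * a = 1.
Proof.
move=> a0.
have /(@nov_min a predT)[l [_ al lP]] : exists2 l, predT l & a l != 0.
  apply: contra_notP (negP a0) => /forall2NP al; apply/eqP/nov_ext => l.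
  by have [//|/negP] := al l; rewrite negbK => /eqP.
pose c := nov_mono (a l)^-1 (- l); pose u := 1 - c * a.
have ul m : u m != 0 -> 0 < m.
  rewrite /u nov_coefB [X in _ - X]conv_mono opprK /=.
  have [->|m0] := eqVneq m 0; first by rewrite add0r mulVf // subrr eqxx.
  rewrite sub0r oppr_eq0 mulf_eq0 negb_or => /andP[_ /(lP _ isT)].
  by rewrite lerDr lt_neqAle eq_sym m0.
have [e e0 eP] : exists2 e, 0 < e & forall m, u m != 0 -> e <= m.
  have [[m um]|/forallNP nu] := pselect (exists m, u m != 0).
    have /(@nov_min u predT)[e [_ ue eP]] : exists2 m, predT m & u m != 0.
      by exists m.
    by exists e; [apply: ul | move=> n; apply: eP].
  by exists 1 => // m /nu.
have [b] := nov_geom e0 eP; rewrite /u subKr mulrA => ba.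
by exists (b * c).
Qed.

Definition nov_inv a : novikov R K := xget 0 [set b | b * a = 1].

Fact nov_mulVf a : a != 0 -> nov_inv a * a = 1.
Proof. by move=> /nov_has_inv[b ba]; rewrite /nov_inv; case: xgetP => // /(_ b). Qed.

Fact nov_inv0 : nov_inv 0 = 0.
Proof.
rewrite /nov_inv; case: xgetP => // b _ /=; rewrite mulr0 => /eqP.
by rewrite eq_sym oner_eq0.
Qed.

HB.instance Definition _ :=
  GRing.ComNzRing_isField.Build (novikov R K) nov_mulVf nov_inv0.

End NovikovRing.

Section NovikovSum.
Variables (R : realType) (K : fieldType).

(** The family [x] tends to [0] in the energy filtration. *)
Definition nov_summable (I : Type) (x : I -> novikov R K) : Prop :=
  forall E : R, finite_set [set i | exists2 l, l <= E & x i l != 0].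

Lemma nov_sumP (I : choiceType) (x : I -> novikov R K) : nov_summable x ->
  locally_finite (fun l => \sum_(i \in [set: I]) x i l).
Proof.
move=> xP E; apply: (sub_finite_set
    (B := \bigcup_(i in [set i | exists2 l, l <= E & x i l != 0])
            [set l | l <= E /\ x i l != 0])); last first.
  by apply: bigcup_finite => // i _; apply: novP.
move=> l /= [lE]; have [[i xil] _|/forallNP xl] := pselect (exists i, x i l != 0).
  by exists i => //=; exists l.
by rewrite fsbig1 ?eqxx // => i _; apply/eqP; rewrite -[_ == _]negbK; apply/negP.
Qed.

(** Sum of a family, convergent in the energy topology; [0] by convention if
    the family is not summable. *)
Definition nov_sum (I : choiceType) (x : I -> novikov R K) : novikov R K :=
  if pselect (nov_summable x) is left xP then Novikov (nov_sumP xP) else 0.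

Definition nov_T : novikov R K := nov_mono 1 1.

End NovikovSum.

Inductive clbasis := Ce | Cf1 | Cf2 | Cf12.

Definition clbasis_pair (b : clbasis) : bool * bool :=
  match b with
  | Ce => (false, false) | Cf1 => (true, false)
  | Cf2 => (false, true) | Cf12 => (true, true)
  end.
Definition pair_clbasis (p : bool * bool) : clbasis :=
  match p with
  | (false, false) => Ce | (true, false) => Cf1
  | (false, true) => Cf2 | (true, true) => Cf12
  end.
Fact clbasis_pairK : cancel clbasis_pair pair_clbasis. Proof. by case. Qed.
HB.instance Definition _ := Finite.copy clbasis (can_type clbasis_pairK).

Definition cldeg (b : clbasis) : nat :=
  match b with Ce => 0 | Cf1 => 1 | Cf2 => 1 | Cf12 => 2 end.

(* The grading is modulo 2, so the shifted degree [|b| - 1] may be represented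
   by the natural number [|b| + 1]: it only occurs in signs and parities. *)
Definition sdeg (b : clbasis) : nat := (cldeg b).+1.
Definition sdegs (w : seq clbasis) : nat := \sum_(b <- w) sdeg b.

Section Ainfinity.
Variables (R : realType) (K : fieldType).
Local Notation Lambda := (novikov R K).

Definition clmod := {ffun clbasis -> Lambda^o}.
Definition clvec (b : clbasis) : clmod := [ffun b' => (b' == b)%:R].

(** A word [b_1 ... b_n] in the basis stands for [b_1 (x) ... (x) b_n]; a tensor
    is a family of coefficients indexed by words of all lengths, i.e. a possibly
    infinite formal combination of words. *)
Definition tensor := seq clbasis -> Lambda^o.

Definition word (w : seq clbasis) : tensor := fun v => (v == w)%:R.

(* [p (x) a (x) s] *)
Definition insert (p : seq clbasis) (a : clmod) (s : seq clbasis) : tensor :=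
  \sum_(b : clbasis) a b *: word (p ++ b :: s).

(** Continuous linear extension of a map given on words. *)
Definition tlift (phi : seq clbasis -> tensor) (c : tensor) : tensor :=
  fun v => nov_sum (fun w => c w * phi w v).

(** [t_n] on words of length [n]. *)
Definition cyc_word (w : seq clbasis) : tensor :=
  if w is x :: s then
    (-1) ^+ (sdeg (last x s) * sdegs (belast x s))
      *: word (last x s :: belast x s)
  else word [::].
Definition cyc : tensor -> tensor := tlift cyc_word.

(** [N_n] on words of length [n]. *)
Definition cyc_norm (w : seq clbasis) : tensor :=
  \sum_(j < size w) iter j cyc (word w).

(** [C_*(A, A)]: the energy completion of the sum of the [A[1]^(x) n], [n > 0]. *)
Definition chain (c : tensor) : Prop := c [::] = 0 /\ nov_summable c.

Definition cyclic_chain (c : tensor) : Prop := chain c /\ cyc c = c.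

(** A family of multilinear maps [m_k : A[1]^(x) k -> A[1]] is encoded by its
    values [m (b_1 ... b_k)] on words. *)
Implicit Types (m : seq clbasis -> clmod) (g : clmod -> clmod -> Lambda).

Definition mhat_word m (k : nat) (w : seq clbasis) : tensor :=
  \sum_(i < (size w).+1 - k)
    (-1) ^+ sdegs (take i w)
      *: insert (take i w) (m (take k (drop i w))) (drop (i + k) w).

(* [mhat_word m k w] vanishes for [k > size w]. *)
Definition dhat_word m (w : seq clbasis) : tensor :=
  \sum_(k < (size w).+1) mhat_word m k w.

Definition dhat m : tensor -> tensor := tlift (dhat_word m).

(** [m^+], given on words by [m^+ (x_1 ... x_k) = <m (x_1 ... x_(k-1)), x_k>]. *)
Definition mplus_word m g (w : seq clbasis) : Lambda :=
  if w is x :: s then g (m (belast x s)) (clvec (last x s)) else 0.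
Definition mplus m g (c : tensor) : Lambda :=
  nov_sum (fun w => c w * mplus_word m g w).

(** The cycle [c] represents a nonzero class in the homology of the cyclic
    complex. *)
Definition nontrivial_cyclic_cycle m (c : tensor) : Prop :=
  [/\ cyclic_chain c, dhat m c = 0
    & ~ exists2 b, cyclic_chain b & dhat m b = c].

(* The [m_k] are sums over disc classes weighted by [T] to the power of their
   area, which is nonnegative; this makes [dhat] converge on the completion. *)
Definition nonneg_energy m : Prop :=
  forall w b l, m w b l != 0 -> 0 <= l.

Definition degree_one m : Prop :=
  forall w b, m w b != 0 -> odd (sdeg b) = odd (sdegs w).+1.

Definition Ainf_equations m : Prop :=
  forall w, dhat m (dhat m (word w)) = 0.

Definition strict_unit m : Prop :=
  (forall x, m [:: Ce; x] = clvec x /\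
             (-1) ^+ cldeg x *: m [:: x; Ce] = clvec x) /\
  (forall w, Ce \in w -> size w != 2%N -> m w = 0).

Definition bilinear_form g : Prop :=
  (forall a x y z, g (a *: x + y) z = a * g x z + g y z) /\
  (forall a x y z, g z (a *: x + y) = a * g z x + g z y).

Definition nondegenerate g : Prop :=
  forall x, (forall y, g x y = 0) -> x = 0.

Definition graded_skew g : Prop := forall a b,
  g (clvec a) (clvec b) = - (-1) ^+ (sdeg a * sdeg b) * g (clvec b) (clvec a).

Definition cyclic_structure m g : Prop := forall x s y,
  g (m (x :: s)) (clvec y) =
    (-1) ^+ (sdeg x * sdegs (rcons s y)) * g (m (rcons s y)) (clvec x).

(** The intersection numbers of the boundaries of the three Maslov index 2 disc
    classes with [e_1 = dx] and [e_2 = dy]. *)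
Definition disc_boundary (j : 'I_3) : int * int :=
  nth (0, 0) [:: (-1, -1); (1, 0); (0, 1)] j.

(* [f_1 = (e_1 + e_2) / sqrt 2] and [f_2 = (e_1 - e_2) / sqrt 2]; only meant
   for arguments of degree 1. *)
Definition disc_cap (sqrt2 : K) (j : 'I_3) (b : clbasis) : K :=
  let: (p1, p2) := disc_boundary j in
  match b with
  | Cf1 => (p1%:~R + p2%:~R) / sqrt2
  | Cf2 => (p1%:~R - p2%:~R) / sqrt2
  | _ => 0
  end.

Definition m3_coef (sqrt2 : K) (w : seq clbasis) : K :=
  3`!%:R^-1 * \sum_(j < 3) \prod_(b <- w) disc_cap sqrt2 j b.

(** [(m, g)] has all the properties of the canonical model of the Clifford torus
    with [m_0] replaced by [0]. *)
Record clifford_torus_model (sqrt2 : K) m g : Prop := CliffordTorusModel {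
  ct_energy : nonneg_energy m;
  ct_degree : degree_one m;
  ct_m0 : m [::] = 0;
  ct_m1 : forall x, m [:: x] = 0;
  ct_Ainf : Ainf_equations m;
  ct_unit : strict_unit m;
  ct_m2_11 : m [:: Cf1; Cf1] = (3 / 2 * nov_T R K) *: clvec Ce;
  ct_m2_22 : m [:: Cf2; Cf2] = (1 / 2 * nov_T R K) *: clvec Ce;
  ct_m2_12 : m [:: Cf1; Cf2] = clvec Cf12;
  ct_m2_21 : m [:: Cf2; Cf1] = - clvec Cf12;
  ct_m3 : forall x y z, cldeg x = 1%N -> cldeg y = 1%N -> cldeg z = 1%N ->
    m [:: x; y; z] = nov_mono (m3_coef sqrt2 [:: x; y; z]) 1 *: clvec Ce;
  ct_bilinear : bilinear_form g;
  ct_nondegenerate : nondegenerate g;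
  ct_skew : graded_skew g;
  ct_cyclic : cyclic_structure m g;
  ct_pair_12 : g (clvec Cf1) (clvec Cf2) = 1;
  ct_pair_21 : g (clvec Cf2) (clvec Cf1) = -1;
  ct_pair_f12e : g (clvec Cf12) (clvec Ce) = 1;
  ct_pair_ef12 : g (clvec Ce) (clvec Cf12) = 1 }.

End Ainfinity.

(* Main.v *)
Require Import Defs.
From mathcomp Require Import all_boot all_order all_algebra.
From mathcomp Require Import all_classical all_reals.
From mathcomp Require Import ring zify.
Import Order.TTheory GRing.Theory Num.Theory.
Local Open Scope ring_scope.
Set Implicit Arguments.
Unset Strict Implicit.
Unset Printing Implicit Defensive.

(** Non-triviality holds because [m^+] vanishes on boundaries of cyclic chains,
    while [m^+ alpha = 18 T].  For a cyclic chain [c] let [Q_k] be the sum over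
    the words [q s] of length [n] with [q] of length [k] of
    [c (q s) <m s, m q>].  Applying [m] to an interval [q] of a word [p q r] and
    pairing the rest with it only depends on the rotated word [q r p], so every
    interval of length [k] contributes [Q_k] to [m^+ (dhat c)], which is thus
    [\sum_k (n + 1 - k) Q_k].  The intervals that avoid the last letter
    contribute zero by the A-infinity equation, i.e. [\sum_k (n - k) Q_k = 0].
    Graded skew-symmetry gives [Q_k = Q_(n-k)], hence [n \sum_k Q_k = 0] and
    everything vanishes in characteristic 0.

    The products of [f_12] with [f_1] and [f_2] follow from the A-infinity
    equation on three letters, and the relevant values of [m_3] from cyclicity
    and nondegeneracy. *)

(** * Energy estimates and convergent sums in the Novikov field *)

Section NovikovLemmas.
Variables (R : realType) (K : fieldType).
Local Notation Lambda := (novikov R K).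

(** The [T^0] coefficient of the integer [n] is [n] itself, so characteristic 0 passes from [K] to
    the Novikov field. *)
Lemma nov_pchar : [pchar K] =i pred0 -> [pchar Lambda] =i pred0.
Proof.
move=> /pcharf0P charK; apply/pcharf0P => -[|n]; first by rewrite mulr0n !eqxx.
apply/negP => /eqP /(congr1 (fun a : Lambda => a 0)).
have coefMn (k : nat) : (k%:R : Lambda) 0 = k%:R.
  elim: k => [|k IHk]; first by [].
  by rewrite !mulrS nov_coefD IHk nov_coef_mono eqxx.
by rewrite coefMn => /eqP; rewrite charK.
Qed.

Lemma nov_summable_seq (I : choiceType) (x : I -> Lambda) (s : seq I) :
  (forall i, i \notin s -> x i = 0) -> nov_summable x.
Proof.
move=> xs E; apply: sub_finite_set (finite_seq s) => i /= [l _].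
by apply: contraR => /xs ->; rewrite nov_coef0.
Qed.

Lemma nov_sumE (I : choiceType) (x : I -> Lambda) l : nov_summable x ->
  nov_sum x l = (\sum_(i \in [set: I]) x i l)%R.
Proof. by rewrite /nov_sum; case: pselect. Qed.

Lemma nov_sum_seq (I : choiceType) (x : I -> Lambda) (s : seq I) : uniq s ->
  (forall i, i \notin s -> x i = 0) -> nov_sum x = \sum_(i <- s) x i.
Proof.
move=> us xs; apply: nov_ext => l.
rewrite nov_sumE; last exact: nov_summable_seq xs.
rewrite nov_coef_sum [RHS]fsbig_seq //; symmetry.
by apply: fsbig_widen => // i /= [_ /negP] /xs ->.
Qed.

(** Convergent sums are computed exponent by exponent, so two families that agree only at [l] can be
    compared there. This lets a chain be replaced by a truncation. *)
Lemma nov_sum_low (I : choiceType) (x y : I -> Lambda) l :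
    nov_summable x -> nov_summable y -> (forall i, x i l = y i l) ->
  nov_sum x l = nov_sum y l.
Proof. by move=> xP yP xy; rewrite !nov_sumE //; apply: eq_fsbigr. Qed.

(** The energy valuation of [x] is at least [E]; phrased so that [x = 0] satisfies every bound. *)
Definition supp_ge (E : R) (x : Lambda) : Prop := forall l, x l != 0 -> E <= l.

Lemma supp_ge0 E : supp_ge E 0.
Proof. by move=> l; rewrite nov_coef0 eqxx. Qed.

Lemma supp_ge1 : supp_ge 0 1.
Proof. by move=> l; rewrite nov_coef_mono; case: ifP => [/eqP ->|]; rewrite ?eqxx. Qed.

Lemma supp_geN E x : supp_ge E x -> supp_ge E (- x).
Proof. by move=> xE l; rewrite nov_coefN oppr_eq0; apply: xE. Qed.

Lemma supp_geD E x y : supp_ge E x -> supp_ge E y -> supp_ge E (x + y).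
Proof.
move=> xE yE l; rewrite nov_coefD.
by have [->|/xE //] := eqVneq (x l) 0; rewrite add0r; apply: yE.
Qed.

Lemma supp_geM E F x y : supp_ge E x -> supp_ge F y -> supp_ge (E + F) (x * y).
Proof.
move=> xE yF l /conv_neq0[m [/xE Em /yF Fl]].
by rewrite -[l](subrK m) addrC lerD.
Qed.

Lemma supp_ge_sum E (I : Type) (r : seq I) (P : pred I) (F : I -> Lambda) :
  (forall i, P i -> supp_ge E (F i)) -> supp_ge E (\sum_(i <- r | P i) F i).
Proof. by move=> FE; apply: big_ind => //; [apply: supp_ge0 | apply: supp_geD]. Qed.

Lemma supp_ge_sign n : supp_ge 0 ((-1) ^+ n).
Proof.
rewrite -signr_odd; case: (odd n); last exact: supp_ge1.
exact/supp_geN/supp_ge1.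
Qed.

Lemma supp_ge_bool (b : bool) : supp_ge 0 b%:R.
Proof. by case: b; [apply: supp_ge1 | apply: supp_ge0]. Qed.

(** As [z] starts at energy [F], the coefficient of [T^l] in a product with [z] only sees exponents
    up to [l - F] of the other factor. *)
Lemma nov_coefM_low (E F l : R) (x y z : Lambda) :
    (forall k, k <= E -> x k = y k) -> supp_ge F z -> l <= E + F ->
  (x * z) l = (y * z) l.
Proof.
move=> xy zF lE; rewrite !nov_coefM; apply: eq_fsbigr => k _.
have [->|/zF Fk] := eqVneq (z (l - k)) 0; first by rewrite !mulr0.
by rewrite xy // -(lerD2r F) (le_trans _ lE) // addrC -lerBrDr.
Qed.

Lemma nov_summableM (I : choiceType) (x y : I -> Lambda) :
    nov_summable x -> (forall i, supp_ge 0 (y i)) ->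
  nov_summable (fun i => x i * y i).
Proof.
move=> xP y0 E; apply: sub_finite_set (xP E) => i /= [l lE /conv_neq0[k [xk yk]]].
by exists k => //; apply: le_trans lE; rewrite -subr_ge0; apply: y0 yk.
Qed.

End NovikovLemmas.

(** * Finitely supported tensors and linear extension from words *)

Section Pairing.
Variables (R : realType) (K : fieldType).
Local Notation Lambda := (novikov R K).
Local Notation tensor := (tensor R K).
Implicit Types (c d : tensor) (h : seq clbasis -> Lambda).

(** Finite support ensures that [nov_sum] is a genuine sum, never its default value 0, whatever
    function the tensor is paired with; linearity is proved under this condition. *)
Definition finsupp c : Prop :=
  exists s : seq (seq clbasis), forall w, w \notin s -> c w = 0 :> Lambda.

Lemma tensorD c d w : (c + d) w = (c w : Lambda) + d w. Proof. by []. Qed.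

Lemma tensorZ (a : Lambda) c w : (a *: c) w = a * c w. Proof. by []. Qed.

Lemma finsupp0 : finsupp 0. Proof. by exists [::]. Qed.

Lemma finsuppD c d : finsupp c -> finsupp d -> finsupp (c + d).
Proof.
move=> [s sP] [t tP]; exists (s ++ t) => w; rewrite mem_cat negb_or => /andP[ws wt].
by rewrite tensorD sP // tP // addr0.
Qed.

Lemma finsuppZ (a : Lambda) c : finsupp c -> finsupp (a *: c).
Proof. by move=> [s sP]; exists s => w /sP cw; rewrite tensorZ cw mulr0. Qed.

Lemma finsupp_sum (I : Type) (r : seq I) (P : pred I) (F : I -> tensor) :
  (forall i, P i -> finsupp (F i)) -> finsupp (\sum_(i <- r | P i) F i).
Proof. by move=> Ff; apply: big_ind => //; [apply: finsupp0 | apply: finsuppD]. Qed.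

Lemma finsupp_word w : finsupp (word R K w).
Proof. by exists [:: w] => v; rewrite inE /word => /negbTE ->. Qed.

(** Both [tlift phi c v] and [mplus m g c] unfold to a pairing, so the same linearity lemmas serve
    [dhat], [cyc] and [m^+]. *)
Definition pairing h c : Lambda := nov_sum (fun w => c w * h w).

Lemma finsupp_pairingP c h : finsupp c -> nov_summable (fun w => c w * h w).
Proof.
by move=> [s sP]; apply: (@nov_summable_seq _ _ _ _ s) => w /sP ->; rewrite mul0r.
Qed.

Lemma pairing_seq h c s : uniq s -> (forall w, w \notin s -> c w = 0 :> Lambda) ->
  pairing h c = \sum_(w <- s) c w * h w.
Proof. by move=> us sP; apply: nov_sum_seq => // w /sP ->; rewrite mul0r. Qed.

Lemma pairingD h c d : finsupp c -> finsupp d ->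
  pairing h (c + d) = pairing h c + pairing h d.
Proof.
move=> [s sP] [t tP]; pose u := undup (s ++ t).
have us w : w \notin u -> c w = 0 :> Lambda.
  by rewrite mem_undup mem_cat negb_or => /andP[/sP].
have ut w : w \notin u -> d w = 0 :> Lambda.
  by rewrite mem_undup mem_cat negb_or => /andP[_ /tP].
rewrite !(@pairing_seq _ _ u) ?undup_uniq //.
  by rewrite -big_split /=; apply: eq_bigr => w _; rewrite -mulrDl.
by move=> w uw; rewrite tensorD us // ut // addr0.
Qed.

Lemma pairingZ h (a : Lambda) c : finsupp c -> pairing h (a *: c) = a * pairing h c.
Proof.
move=> [s sP]; rewrite !(@pairing_seq _ _ (undup s)) ?undup_uniq //.
- by rewrite mulr_sumr; apply: eq_bigr => w _; rewrite mulrA.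
- by move=> w; rewrite mem_undup => /sP.
- by move=> w; rewrite mem_undup => /sP cw; rewrite tensorZ cw mulr0.
Qed.

Lemma pairing0 h : pairing h 0 = 0.
Proof. by rewrite (@pairing_seq _ _ [::]) // big_nil. Qed.

Lemma pairing_sum h (I : Type) (r : seq I) (F : I -> tensor) :
  (forall i, finsupp (F i)) ->
  pairing h (\sum_(i <- r) F i) = \sum_(i <- r) pairing h (F i).
Proof.
move=> Ff; elim: r => [|i r IHr]; first by rewrite !big_nil pairing0.
by rewrite !big_cons pairingD ?IHr //; apply: finsupp_sum.
Qed.

Lemma pairing_word h w : pairing h (word R K w) = h w.
Proof.
rewrite (@pairing_seq _ _ [:: w]) // ?big_seq1 /word ?eqxx ?mul1r // => v.
by rewrite inE => /negbTE ->.
Qed.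

Lemma tliftE phi c v : tlift phi c v = pairing (phi^~ v) c. Proof. by []. Qed.

Lemma tlift_word (phi : seq clbasis -> tensor) w : tlift phi (word R K w) = phi w.
Proof. by apply/funext => v; rewrite tliftE pairing_word. Qed.

Lemma tliftZ phi (a : Lambda) c : finsupp c -> tlift phi (a *: c) = a *: tlift phi c.
Proof. by move=> cf; apply/funext => v; rewrite tliftE pairingZ. Qed.

Lemma tlift_sum phi (I : Type) (r : seq I) (F : I -> tensor) :
  (forall i, finsupp (F i)) ->
  tlift phi (\sum_(i <- r) F i) = \sum_(i <- r) tlift phi (F i).
Proof. by move=> Ff; apply/funext => v; rewrite tliftE pairing_sum // fct_sumE. Qed.

Lemma finsupp_words (l : seq (Lambda * seq clbasis)) :
  finsupp (\sum_(p <- l) p.1 *: word R K p.2).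
Proof. by apply: finsupp_sum => p _; apply/finsuppZ/finsupp_word. Qed.

Lemma pairing_words h (l : seq (Lambda * seq clbasis)) :
  pairing h (\sum_(p <- l) p.1 *: word R K p.2) = \sum_(p <- l) p.1 * h p.2.
Proof.
rewrite pairing_sum => [|p]; last exact/finsuppZ/finsupp_word.
by apply: eq_bigr => p _; rewrite pairingZ ?pairing_word //; apply: finsupp_word.
Qed.

Lemma tlift_words phi (l : seq (Lambda * seq clbasis)) :
  tlift phi (\sum_(p <- l) p.1 *: word R K p.2) = \sum_(p <- l) p.1 *: phi p.2.
Proof. by apply/funext => v; rewrite tliftE pairing_words fct_sumE. Qed.

Lemma insert0 p s : insert p (0 : clmod R K) s = 0.
Proof. by rewrite /insert big1 // => b _; rewrite ffunE scale0r. Qed.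

Lemma insertE p (a : clmod R K) s v :
  insert p a s v = \sum_b a b * (v == p ++ b :: s)%:R.
Proof. by rewrite /insert fct_sumE. Qed.

Lemma insertD p (a b : clmod R K) s : insert p (a + b) s = insert p a s + insert p b s.
Proof.
by rewrite /insert -big_split; apply: eq_bigr => x _; rewrite ffunE scalerDl.
Qed.

Lemma insertZ p (l : Lambda) (a : clmod R K) s :
  insert p (l *: a) s = l *: insert p a s.
Proof.
by rewrite /insert scaler_sumr; apply: eq_bigr => x _; rewrite ffunE scalerA.
Qed.

Lemma insert_clvec p b s : insert p (clvec R K b) s = word R K (p ++ b :: s).
Proof.
rewrite /insert (bigD1 b) //= ffunE eqxx scale1r big1 ?addr0 // => x /negbTE xb.
by rewrite ffunE xb scale0r.
Qed.

Lemma finsupp_insert p (a : clmod R K) s : finsupp (insert p a s).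
Proof. by apply: finsupp_sum => b _; apply/finsuppZ/finsupp_word. Qed.

Lemma pairing_insert h p (a : clmod R K) s :
  pairing h (insert p a s) = \sum_b a b * h (p ++ b :: s).
Proof.
rewrite pairing_sum => [|b]; last exact/finsuppZ/finsupp_word.
by apply: eq_bigr => b _; rewrite pairingZ ?pairing_word //; apply: finsupp_word.
Qed.

Variable m : seq clbasis -> clmod R K.

Lemma finsupp_mhat_word k w : finsupp (mhat_word m k w).
Proof. by apply: finsupp_sum => i _; apply/finsuppZ/finsupp_insert. Qed.

Lemma finsupp_dhat_word w : finsupp (dhat_word m w).
Proof. by apply: finsupp_sum => k _; apply: finsupp_mhat_word. Qed.

Lemma pairing_dhat_word h w : pairing h (dhat_word m w) =
  \sum_(k < (size w).+1) \sum_(i < (size w).+1 - k) (-1) ^+ sdegs (take i w) *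
     \sum_b m (take k (drop i w)) b * h (take i w ++ b :: drop (i + k) w).
Proof.
rewrite pairing_sum; last by move=> k; apply: finsupp_mhat_word.
apply: eq_bigr => k _; rewrite pairing_sum; last first.
  by move=> i; apply/finsuppZ/finsupp_insert.
by apply: eq_bigr => i _; rewrite pairingZ ?pairing_insert //; apply: finsupp_insert.
Qed.

Lemma supp_ge_dhat_word : nonneg_energy m -> forall w v, supp_ge 0 (dhat_word m w v).
Proof.
move=> m0 w v; rewrite /dhat_word fct_sumE; apply: supp_ge_sum => k _.
rewrite /mhat_word fct_sumE; apply: supp_ge_sum => i _.
rewrite -[0 : R]addr0; apply: supp_geM; first exact: supp_ge_sign.
rewrite insertE; apply: supp_ge_sum => b _; rewrite -[0 : R]addr0.
by apply: supp_geM; [move=> l; apply: m0 | apply: supp_ge_bool].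
Qed.

(** Only the application of [m] to the whole word leaves a single letter. Reading
    [dhat (dhat w) = 0] at one-letter words therefore yields the usual A-infinity equation. *)
Lemma dhat_word1 w (c : clbasis) : dhat_word m w [:: c] = m w c.
Proof.
rewrite /dhat_word fct_sumE (bigD1 ord_max) //= [X in _ + X]big1 ?addr0.
  rewrite /mhat_word fct_sumE; set n := (_ - _)%N.
  have -> : n = 1%N by rewrite /n subSnn.
  rewrite big_ord1 /= take0 drop0 take_size add0n drop_size /sdegs big_nil expr0.
  rewrite scale1r insertE (bigD1 c) //= eqxx mulr1 big1 ?addr0 // => b bc.
  by rewrite eqseq_cons eq_sym (negbTE bc) mulr0.
move=> k kw; rewrite /mhat_word fct_sumE big1 // => i _.
rewrite tensorZ insertE big1 ?mulr0 // => b _.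
suff /negbTE -> : [:: c] != take i w ++ b :: drop (i + k) w by rewrite mulr0.
apply: contra kw => /eqP /(congr1 size) /=.
have ik : (i + k <= size w)%N.
  by have := ltn_ord i; lia.
rewrite size_cat /= size_take_min size_drop (minn_idPl _); last first.
  exact: leq_trans (leq_addr _ _) ik.
move=> E; apply/eqP/val_inj => /=; lia.
Qed.

End Pairing.

Lemma sdegs_cat s t : sdegs (s ++ t) = (sdegs s + sdegs t)%N.
Proof. by rewrite /sdegs big_cat. Qed.

Lemma sdegs_cons x s : sdegs (x :: s) = (sdeg x + sdegs s)%N.
Proof. by rewrite /sdegs big_cons. Qed.

Lemma sdegs_rcons s x : sdegs (rcons s x) = (sdegs s + sdeg x)%N.
Proof. by rewrite -cats1 sdegs_cat /sdegs big_seq1. Qed.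

(** * Functions on words that are cyclic up to sign *)

Section CyclicFunctions.
Variables (R : realType) (K : fieldType).
Local Notation Lambda := (novikov R K).
Implicit Types (c d : tensor R K) (h : seq clbasis -> Lambda).

(** This rule is shared by the coefficients of a cyclic chain and by [m^+], so both can be rotated
    by the same lemma. *)
Definition cyclic_function h : Prop := forall x s,
  h (x :: s) = (-1) ^+ (sdeg x * sdegs s) * h (rcons s x).

(** The letters of [p] move to the end one at a time. Each letter passes the later letters of [p]
    and is then passed by them, so those two signs cancel. *)
Lemma cyclic_function_cat h p s : cyclic_function h ->
  h (p ++ s) = (-1) ^+ (sdegs p * sdegs s) * h (s ++ p).
Proof.
move=> hc; elim: p s => [|x p IHp] s.
  by rewrite cats0 /sdegs big_nil mul0n expr0 mul1r.
rewrite cat_cons hc -cat_rcons -cats1 -catA IHp -catA mulrA -exprD.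
congr (_ * _); last by rewrite cat_rcons.
rewrite -signr_odd -[RHS]signr_odd; congr (_ ^+ nat_of_bool _).
rewrite cats1 sdegs_rcons sdegs_cons sdegs_cat !(oddD, oddM).
by case: (odd (sdeg x)) (odd (sdegs p)) (odd (sdegs s)) => [] [] [].
Qed.

(** Invariance is read at [x :: s]: the only word that [cyc_word] rotates onto it is [rcons s x], so
    the sum defining [cyc c] has one term there. *)
Lemma cyclic_chain_function c : cyclic_chain c -> cyclic_function c.
Proof.
move=> [_ cc] x s; rewrite -[in LHS]cc /cyc tliftE.
rewrite /pairing (@nov_sum_seq _ _ _ _ [:: rcons s x]) // ?big_seq1.
  case E : (rcons s x) => [|y t]; first by case: (s) E.
  rewrite /cyc_word tensorZ.
  have /= <- : last x (rcons s x) = last y t by rewrite E.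
  have -> : belast y t = s.
    by move: E; rewrite (lastI y t) => /rcons_inj[->].
  by rewrite last_rcons /word eqxx mulr1 mulrC.
move=> w; rewrite inE => ws; case: w ws => [|y t] ws.
  by rewrite /cyc_word /word mulr0.
rewrite /cyc_word tensorZ /word; case: eqP => [[E1 E2]|_]; last by rewrite !mulr0.
by move: ws; rewrite lastI -E1 -E2 eqxx.
Qed.

End CyclicFunctions.

(** * The bilinear form evaluated on outputs of [m] *)

Section CyclicAlgebra.
Variables (R : realType) (K : fieldType).
Local Notation Lambda := (novikov R K).
Local Notation clmod := (clmod R K).
Local Notation clvec := (clvec R K).
Variables (m : seq clbasis -> clmod) (g : clmod -> clmod -> Lambda).

Lemma clmod_sum (x : clmod) : x = \sum_b x b *: clvec b.
Proof.
apply/ffunP => c; rewrite sum_ffunE (bigD1 c) //= !ffunE eqxx [_ *: _]mulr1.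
by rewrite big1 ?addr0 // => b /negbTE bc; rewrite !ffunE eq_sym bc [LHS]mulr0.
Qed.

Hypothesis gbil : bilinear_form g.

Lemma bilin0l z : g 0 z = 0.
Proof.
have := gbil.1 1 0 0 z; rewrite scale1r add0r mul1r => /eqP.
by rewrite -subr_eq subrr eq_sym => /eqP.
Qed.

Lemma bilin0r z : g z 0 = 0.
Proof.
have := gbil.2 1 0 0 z; rewrite scale1r add0r mul1r => /eqP.
by rewrite -subr_eq subrr eq_sym => /eqP.
Qed.

Lemma bilinDl x y z : g (x + y) z = g x z + g y z.
Proof. by have := gbil.1 1 x y z; rewrite scale1r mul1r. Qed.

Lemma bilinDr x y z : g z (x + y) = g z x + g z y.
Proof. by have := gbil.2 1 x y z; rewrite scale1r mul1r. Qed.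

Lemma bilinZl (a : Lambda) x z : g (a *: x) z = a * g x z.
Proof. by have := gbil.1 a x 0 z; rewrite bilin0l !addr0. Qed.

Lemma bilinZr (a : Lambda) x z : g z (a *: x) = a * g z x.
Proof. by have := gbil.2 a x 0 z; rewrite bilin0r !addr0. Qed.

Lemma bilinNl x z : g (- x) z = - g x z.
Proof. by rewrite -scaleN1r bilinZl mulN1r. Qed.

Lemma bilin_suml (I : Type) (r : seq I) (F : I -> clmod) z :
  g (\sum_(i <- r) F i) z = \sum_(i <- r) g (F i) z.
Proof.
by elim: r => [|i r IHr]; rewrite ?big_nil ?bilin0l // !big_cons bilinDl IHr.
Qed.

Lemma bilin_sumr (I : Type) (r : seq I) (F : I -> clmod) z :
  g z (\sum_(i <- r) F i) = \sum_(i <- r) g z (F i).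
Proof.
by elim: r => [|i r IHr]; rewrite ?big_nil ?bilin0r // !big_cons bilinDr IHr.
Qed.

Lemma bilinEl x z : g x z = \sum_b x b * g (clvec b) z.
Proof.
by rewrite {1}[x]clmod_sum bilin_suml; apply: eq_bigr => b _; rewrite bilinZl.
Qed.

Lemma bilinEr x z : g z x = \sum_b x b * g z (clvec b).
Proof.
by rewrite {1}[x]clmod_sum bilin_sumr; apply: eq_bigr => b _; rewrite bilinZr.
Qed.

Lemma mplus_word_rcons s x : mplus_word m g (rcons s x) = g (m s) (clvec x).
Proof.
case: s => [|y s] //=; rewrite -cats1.
by rewrite belast_cat last_cat /= cats1 -lastI.
Qed.

Hypothesis gcyc : cyclic_structure m g.

Lemma mplus_word_cyclic : cyclic_function (mplus_word m g).
Proof.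
move=> x s; case/lastP: s => [|s y].
  by rewrite /sdegs big_nil muln0 expr0 mul1r.
by rewrite -rcons_cons !mplus_word_rcons gcyc.
Qed.

Hypothesis mdeg : degree_one m.
Hypothesis geven : forall a b, odd (sdeg a + sdeg b) -> g (clvec a) (clvec b) = 0.
Hypothesis gskew : graded_skew g.

(** Rotating [r] to the front makes the inserted letter [b] the last one, and the sum over [b]
    expands [m q] in the second slot of [g]. The sign uses that [m] has degree one. *)
Lemma mplus_insert p q r :
  \sum_b m q b * mplus_word m g (p ++ b :: r) =
    (-1) ^+ ((sdegs p + sdegs q).+1 * sdegs r) * g (m (r ++ p)) (m q).
Proof.
rewrite bilinEr mulr_sumr; apply: eq_bigr => b _.
have [->|/mdeg qb] := eqVneq (m q b) 0; first by rewrite !mul0r mulr0.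
rewrite [RHS]mulrCA -cat_rcons (cyclic_function_cat _ _ mplus_word_cyclic).
rewrite -rcons_cat mplus_word_rcons.
suff -> : (-1) ^+ (sdegs (rcons p b) * sdegs r) =
    (-1) ^+ ((sdegs p + sdegs q).+1 * sdegs r) :> Lambda by [].
rewrite -signr_odd -[RHS]signr_odd; congr (_ ^+ nat_of_bool _).
by rewrite sdegs_rcons !oddM oddD qb !oddS oddD addbN.
Qed.

Lemma bilin_m_odd u b : odd (sdegs u).+1 (+) odd (sdeg b) -> g (m u) (clvec b) = 0.
Proof.
move=> ub; rewrite bilinEl big1 // => a _.
have [->|/mdeg ua] := eqVneq (m u a) 0; first by rewrite mul0r.
by rewrite geven ?mulr0 // oddD ua.
Qed.

Lemma bilin_mm_odd u v : odd (sdegs u + sdegs v) -> g (m u) (m v) = 0.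
Proof.
move=> uv; rewrite bilinEr big1 // => b _.
have [->|/mdeg vb] := eqVneq (m v b) 0; first by rewrite mul0r.
by rewrite bilin_m_odd ?mulr0 // vb !oddS addNb addbN negbK -oddD.
Qed.

(** Outputs of [m] have parities [|u| + 1] and [|v| + 1]; the skew sign, with exponent
    [1 + (|u| + 1)(|v| + 1)], reduces to [|u||v|] because [|u| + |v|] is even. *)
Lemma bilin_mm_skew u v : odd (sdegs u) = odd (sdegs v) ->
  g (m u) (m v) = (-1) ^+ (sdegs u * sdegs v) * g (m v) (m u).
Proof.
move=> uv; rewrite [LHS]bilinEl.
under eq_bigr do rewrite bilinEr mulr_sumr.
rewrite exchange_big [in RHS]bilinEl mulr_sumr; apply: eq_bigr => b _ /=.
rewrite [in RHS]bilinEr !mulr_sumr; apply: eq_bigr => a _.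
have [->|/mdeg ua] := eqVneq (m u a) 0; first by rewrite !(mul0r, mulr0).
have [->|/mdeg vb] := eqVneq (m v b) 0; first by rewrite !(mul0r, mulr0).
rewrite gskew -[(-1) ^+ _]signr_odd -[in RHS]signr_odd !oddM ua vb /= uv.
by case: (odd _); rewrite /= ?expr0 ?expr1; ring.
Qed.

End CyclicAlgebra.

Lemma sum_rot (T : finType) (V : nmodType) n (f : seq T -> V) i :
  \sum_(t : n.-tuple T) f (rot i t) = \sum_(t : n.-tuple T) f t.
Proof.
rewrite [RHS](reindex_inj (h := fun t : n.-tuple T => [tuple of rot i t])) //=.
by move=> s t /(congr1 val) /rot_inj /val_inj.
Qed.

(** * Vanishing of [m^+] on boundaries of cyclic chains *)

Section CyclicTrace.
Variables (R : realType) (K : fieldType).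
Local Notation Lambda := (novikov R K).
Local Notation clmod := (clmod R K).
Local Notation clvec := (clvec R K).
Variables (m : seq clbasis -> clmod) (g : clmod -> clmod -> Lambda).
Hypothesis charK : [pchar K] =i pred0.
Hypothesis gbil : bilinear_form g.
Hypothesis gcyc : cyclic_structure m g.
Hypothesis mdeg : degree_one m.
Hypothesis geven : forall a b, odd (sdeg a + sdeg b) -> g (clvec a) (clvec b) = 0.
Hypothesis gskew : graded_skew g.
Hypothesis mAinf : Ainf_equations m.

Lemma Ainf_sum s :
  \sum_(k < (size s).+1) \sum_(i < (size s).+1 - k) (-1) ^+ sdegs (take i s) *:
     (\sum_b m (take k (drop i s)) b *: m (take i s ++ b :: drop (i + k) s)) = 0.
Proof.
apply/ffunP => c; have := congr1 (@^~ [:: c]) (mAinf s).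
rewrite /dhat tlift_word tliftE.
have -> : (dhat_word m)^~ [:: c] = fun w => m w c.
  by apply/funext => w; rewrite dhat_word1.
rewrite pairing_dhat_word ffunE => /= E; rewrite -[RHS]E sum_ffunE.
apply: eq_bigr => k _; rewrite sum_ffunE; apply: eq_bigr => i _.
by rewrite ffunE sum_ffunE; congr (_ * _); apply: eq_bigr => b _; rewrite ffunE.
Qed.

Local Notation dterm w k i := ((-1) ^+ sdegs (take i w) *
  \sum_b m (take k (drop i w)) b * mplus_word m g (take i w ++ b :: drop (i + k) w)).

(** The bounds on [k] and [i] are those of [s], so the intervals are exactly those of [rcons s y]
    that avoid [y]. The sum is the A-infinity equation of [s] paired with [y]. *)
Lemma Ainf_mplus s y :
  \sum_(k < (size s).+1) \sum_(i < (size s).+1 - k) dterm (rcons s y) k i = 0.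
Proof.
have /(congr1 (g^~ (clvec y))) := Ainf_sum s; rewrite /= bilin0l // => E.
rewrite -[RHS]E bilin_suml //; apply: eq_bigr => k _.
rewrite bilin_suml //; apply: eq_bigr => i _.
have ik : (i + k <= size s)%N by have := ltn_ord i; lia.
have si : (i <= size s)%N by lia.
rewrite bilinZl // bilin_suml // -cats1 takel_cat //.
have -> : drop (i + k) (s ++ [:: y]) = rcons (drop (i + k) s) y.
  by rewrite cats1 drop_rcons.
have -> : take k (drop i (s ++ [:: y])) = take k (drop i s).
  by rewrite cats1 drop_rcons // -cats1 takel_cat // size_drop; lia.
congr (_ * _); apply: eq_bigr => b _; rewrite bilinZl //.
by rewrite -rcons_cons -rcons_cat mplus_word_rcons.
Qed.

Section Trace.
Variable c : seq clbasis -> Lambda.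
Hypothesis c_cyc : cyclic_function c.

(** The summand of [Q_k], for [w = q s] cut after [k] letters. *)
Let F k w := c w * g (m (drop k w)) (m (take k w)).

Lemma dterm_rot w k i : (i + k <= size w)%N -> c w * dterm w k i = F k (rot i w).
Proof.
move=> ik; set p := take i w; set q := take k (drop i w); set r := drop (i + k) w.
have qr : drop i w = q ++ r by rewrite /q /r addnC -drop_drop cat_take_drop.
have sq : size q = k by rewrite /q size_takel // size_drop; lia.
have wE : w = p ++ q ++ r by rewrite -qr cat_take_drop.
have -> : rot i w = q ++ r ++ p by rewrite /rot qr catA.
rewrite /F -sq drop_size_cat // take_size_cat // mplus_insert //.
have [odd_w|even_w] := boolP (odd (sdegs (r ++ p) + sdegs q)).
  by rewrite (bilin_mm_odd gbil mdeg geven odd_w) !mulr0.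
(* In even total degree three signs cancel: from rotating [c], from moving [m] past [p], and from
   [mplus_insert]. In odd total degree the pairing vanishes. *)
have sgn : (-1) ^+ (sdegs p * sdegs (q ++ r)) * (-1) ^+ sdegs p *
    (-1) ^+ ((sdegs p + sdegs q).+1 * sdegs r) = 1 :> Lambda.
  rewrite -!exprD -signr_odd; move: even_w.
  rewrite !sdegs_cat !(oddD, oddM, oddS).
  by case: (odd (sdegs p)) (odd (sdegs q)) (odd (sdegs r)) => [] [] [].
rewrite wE (cyclic_function_cat _ _ c_cyc) -catA -[RHS]mul1r -[X in _ = X * _]sgn.
by ring.
Qed.

(** Rotating by [k] exchanges the two factors; the sign of [c] and the sign of skew-symmetry are
    both [|q||s|]. *)
Lemma dterm_flip w k : (k <= size w)%N -> F k w = F (size w - k) (rot k w).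
Proof.
move=> kw; rewrite /F /rot; set q := take k w; set s := drop k w.
have wE : w = q ++ s by rewrite cat_take_drop.
have -> : (size w - k = size s)%N by rewrite size_drop.
rewrite drop_size_cat // take_size_cat // {1}wE.
have [odd_w|even_w] := boolP (odd (sdegs s + sdegs q)).
  rewrite !(bilin_mm_odd gbil mdeg geven) ?mulr0 //; first by rewrite addnC.
rewrite (cyclic_function_cat _ _ c_cyc) [in RHS](bilin_mm_skew gbil mdeg gskew).
  by ring.
by move: even_w; rewrite oddD; do 2!case: odd.
Qed.

Lemma sum_mplus_dhat_word n : c [::] = 0 ->
  \sum_(t : n.-tuple clbasis) c t * pairing (mplus_word m g) (dhat_word m t) = 0.
Proof.
move=> c0; case: n => [|n].
  by rewrite big1 // => t _; rewrite tuple0 c0 mul0r.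
(* The words have length [n.+1], which is the [n] of the overview. *)
pose Q k := \sum_(t : n.+1.-tuple clbasis) F k t.
have QE k i : (i + k <= n.+1)%N ->
    \sum_(t : n.+1.-tuple clbasis) c t * dterm t k i = Q k.
  move=> ik; rewrite -[RHS](@sum_rot _ _ n.+1 (F k) i); apply: eq_bigr => t _.
  by rewrite dterm_rot ?size_tuple.
have sumI (x : Lambda) j : \sum_(i < j) x = x *+ j by rewrite sumr_const card_ord.
have Qflip k : (k <= n.+1)%N -> Q k = Q (n.+1 - k)%N.
  move=> kn; rewrite -[RHS](@sum_rot _ _ n.+1 (F (n.+1 - k)) k); apply: eq_bigr => t _.
  by rewrite dterm_flip size_tuple.
(* There are [n.+1 - k] intervals of length [k] avoiding the last letter; for [k = n.+1] there is
   none, so that term is dropped first. *)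
have Qn : \sum_(k < n.+2) Q k *+ (n.+1 - k) = 0.
  rewrite big_ord_recr /= subnn mulr0n addr0.
  transitivity (\sum_(t : n.+1.-tuple clbasis) c t *
      \sum_(k < n.+1) \sum_(i < n.+1 - k) dterm t k i).
    under [RHS]eq_bigr do rewrite mulr_sumr.
    rewrite exchange_big; apply: eq_bigr => k _ /=.
    under [RHS]eq_bigr do rewrite mulr_sumr.
    rewrite exchange_big /= -sumI.
    by apply: eq_bigr => i _; rewrite QE //; have := ltn_ord i; lia.
  rewrite big1 // => t _; case/lastP: (tval t) (size_tuple t) => // s y.
  by rewrite size_rcons => -[<-]; rewrite Ainf_mplus mulr0.
have Qk : \sum_(k < n.+2) Q k *+ k = 0.
  rewrite -[RHS]Qn (reindex_inj rev_ord_inj); apply: eq_bigr => k _ /=.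
  have kn := ltn_ord k; rewrite subSS [in RHS]Qflip //; lia.
have Q0 : \sum_(k < n.+2) Q k = 0.
  have /eqP : n.+1%:R * (\sum_(k < n.+2) Q k) = 0.
    rewrite mulr_natl -sumrMnl; have := congr2 +%R Qn Qk.
    rewrite /= addr0 -big_split /= => E; rewrite -[RHS]E {E}.
    apply: eq_bigr => k _; rewrite -mulrnDr subnK //; have := ltn_ord k; lia.
  by rewrite mulf_eq0 ((pcharf0P _).1 (nov_pchar R charK)) => /eqP.
(* One more copy of each [Q k] turns the count [n.+1 - k] into [n.+2 - k], the number of all
   intervals of length [k], empty ones included. *)
have := congr2 +%R Qn Q0; rewrite /= addr0 -big_split /= => E; rewrite -[RHS]E {E}.
under eq_bigr do rewrite pairing_dhat_word size_tuple mulr_sumr.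
rewrite exchange_big; apply: eq_bigr => k _ /=.
have kn := ltn_ord k.
under eq_bigr do rewrite mulr_sumr.
rewrite exchange_big /= -mulrSr -sumI.
have -> : ((n.+1 - k).+1 = n.+2 - k)%N by lia.
by apply: eq_bigr => i _; rewrite QE //; have := ltn_ord i; lia.
Qed.

End Trace.

Hypothesis menergy : nonneg_energy m.

(** The form has finitely many values on pairs of basis vectors and [m] has nonnegative energy, so
    one bound, possibly negative, serves all words. *)
Lemma supp_ge_mplus_word : exists E, forall w, supp_ge E (mplus_word m g w).
Proof.
have /choice[X XP] : forall p : clbasis * clbasis,
    exists x, supp_ge x (g (clvec p.1) (clvec p.2)) by move=> p; apply: nov_lb.
have [E _ EX] := seq_lb [seq X p | p <- enum {: clbasis * clbasis}].
exists E => w; case/lastP: w => [|s y]; first exact: supp_ge0.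
rewrite mplus_word_rcons bilinEl // -[E]add0r; apply: supp_ge_sum => b _.
apply: supp_geM => [l|l /(XP (b, y))]; first exact: menergy.
by apply: le_trans; apply/EX/map_f; rewrite mem_enum.
Qed.

(** The chain [c] may be infinite, so the claim is checked at each exponent [l] on a truncation.
    Finite support of the boundary makes the sum defining [m^+] converge. *)
Lemma mplus_dhat_eq0 (c : tensor R K) :
  cyclic_chain c -> finsupp (dhat m c) -> mplus m g (dhat m c) = 0.
Proof.
move=> cc dcf; have [[c0 csum] _] := cc; have ccyc := cyclic_chain_function cc.
have [F FP] := supp_ge_mplus_word; apply: nov_ext => l.
(* Below energy [l - F] the chain [c] agrees with its truncation [cN] to words of
   length at most [N], and this determines the coefficient of [T^l]. *)
have /finite_seqP[s sE] := csum (l - F); pose N := \max_(w <- s) size w.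
pose cN : tensor R K :=
  \sum_(n < N.+1) \sum_(t : n.-tuple clbasis) c t *: word R K t.
have wf n (t : n.-tuple clbasis) : finsupp (c t *: word R K t).
  exact/finsuppZ/finsupp_word.
have nf n : finsupp (\sum_(t : n.-tuple clbasis) c t *: word R K t).
  exact: finsupp_sum.
have cNE w : (size w <= N)%N -> cN w = c w.
  move=> wN; rewrite /cN fct_sumE (bigD1 (Ordinal (wN : (size w < N.+1)%N))) //=.
  rewrite fct_sumE (bigD1 (in_tuple w)) //= tensorZ /word eqxx mulr1.
  rewrite !big1 ?addr0 // => [n nw|t tw].
    rewrite fct_sumE big1 // => t _; rewrite tensorZ /word.
    case: eqP => [E|_]; last by rewrite mulr0.
    by case/eqP: nw; apply: val_inj; rewrite /= E size_tuple.
  rewrite tensorZ /word; case: eqP => [E|_]; last by rewrite mulr0.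
  by case/eqP: tw; apply: val_inj.
have cNN w : (N < size w)%N -> cN w = 0.
  move=> Nw; rewrite /cN fct_sumE big1 // => n _; rewrite fct_sumE big1 // => t _.
  rewrite tensorZ /word; case: eqP => [E|_]; last by rewrite mulr0.
  by move: Nw (ltn_ord n); rewrite E size_tuple; lia.
have low w k : k <= l - F -> c w k = cN w k.
  move=> kl; have [wN|Nw] := leqP (size w) N; first by rewrite cNE.
  rewrite cNN //; apply/eqP; apply: contraLR Nw => cwk.
  have : [set` s]%classic w by rewrite -sE; exists k.
  by rewrite -leqNgt /= => ws; apply: leq_bigmax_seq.
have dcN : dhat m cN =
    \sum_(n < N.+1) \sum_(t : n.-tuple clbasis) c t *: dhat_word m t.
  rewrite /dhat tlift_sum //; apply: eq_bigr => n _; rewrite tlift_sum //.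
  apply: eq_bigr => t _; rewrite tliftZ ?tlift_word //; exact: finsupp_word.
have dwf n (t : n.-tuple clbasis) : finsupp (c t *: dhat_word m t).
  exact/finsuppZ/finsupp_dhat_word.
(* [dhat] does not lower energy, so agreement up to [l - F] survives it; [m^+] then lowers energy by
   at most [- F], which reaches [l]. *)
have dlow v k : k <= l - F -> dhat m c v k = dhat m cN v k.
  move=> kl; apply: nov_sum_low => [||w].
  - by apply: nov_summableM => // w; apply: supp_ge_dhat_word.
  - by apply: finsupp_pairingP; apply: finsupp_sum.
  - apply: (@nov_coefM_low _ _ (l - F) 0); [exact: low| |by rewrite addr0].
    exact: supp_ge_dhat_word.
transitivity (mplus m g (dhat m cN) l).
  apply: nov_sum_low => [||v].
  - exact: finsupp_pairingP.
  - by apply: finsupp_pairingP; rewrite dcN; do 2!apply: finsupp_sum => ? _.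
  - by apply: (@nov_coefM_low _ _ (l - F) F); [exact: dlow | | rewrite subrK].
rewrite dcN [mplus m g _]pairing_sum; last by move=> n; apply: finsupp_sum.
rewrite big1 // => n _; rewrite pairing_sum // -[RHS](@sum_mplus_dhat_word c ccyc n) //.
by apply: eq_bigr => t _; rewrite pairingZ //; apply: finsupp_dhat_word.
Qed.

End CyclicTrace.

(** * Rotations, differential and A-infinity equation on three letters *)

Section ThreeLetterWords.
Variables (R : realType) (K : fieldType).
Local Notation Lambda := (novikov R K).
Local Notation clmod := (clmod R K).
Local Notation clvec := (clvec R K).
Local Notation word := (word R K).
Variable m : seq clbasis -> clmod.

(** The sign exponent is kept as a boolean so that it evaluates on concrete letters. *)
Lemma cyc_word3 x y z : cyc_word R K [:: x; y; z] =
  (-1) ^+ (odd (sdeg z) && odd (sdeg x + sdeg y)) *: word [:: z; x; y].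
Proof.
by rewrite /cyc_word /= -signr_odd oddM !sdegs_cons /sdegs big_nil addn0.
Qed.

Lemma cyc_norm3 x y z : cyc_norm R K [:: x; y; z] =
  word [:: x; y; z]
  + (-1) ^+ (odd (sdeg z) && odd (sdeg x + sdeg y)) *: word [:: z; x; y]
  + ((-1) ^+ (odd (sdeg z) && odd (sdeg x + sdeg y))
     * (-1) ^+ (odd (sdeg y) && odd (sdeg z + sdeg x))) *: word [:: y; z; x].
Proof.
rewrite /cyc_norm !big_ord_recr big_ord0 /= add0r /cyc !tlift_word cyc_word3.
rewrite tliftZ; last exact: finsupp_word.
by rewrite tlift_word cyc_word3 scalerA.
Qed.

Hypothesis m_nil : m [::] = 0.
Hypothesis m_one : forall x, m [:: x] = 0.

Lemma dhat_word3 x y z : dhat_word m [:: x; y; z] =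
  insert [::] (m [:: x; y]) [:: z]
  + (-1) ^+ odd (sdeg x) *: insert [:: x] (m [:: y; z]) [::]
  + insert [::] (m [:: x; y; z]) [::].
Proof.
rewrite /dhat_word !big_ord_recr big_ord0 /= add0r.
have -> : mhat_word m 0 [:: x; y; z] = 0.
  by rewrite /mhat_word big1 // => i _; rewrite take0 m_nil insert0 scaler0.
have -> : mhat_word m 1 [:: x; y; z] = 0.
  rewrite /mhat_word big1 // => i _; case: drop => [|b s].
    by rewrite m_nil insert0 scaler0.
  by rewrite /= take0 m_one insert0 scaler0.
rewrite /mhat_word -[(_ - 2)%N]/2%N -[(_ - 3)%N]/1%N !big_ord_recr !big_ord0 /=.
rewrite !add0r sdegs_cons /sdegs big_nil addn0 expr0 !scale1r.
by rewrite -[(-1) ^+ sdeg x]signr_odd.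
Qed.

(** With [m_0 = m_1 = 0] every term involving [m_3] drops out, leaving associativity of [m_2] up to
    sign. *)
Lemma Ainf3 x y z : Ainf_equations m ->
  \sum_b m [:: x; y] b *: m [:: b; z]
  + (-1) ^+ odd (sdeg x) *: (\sum_b m [:: y; z] b *: m [:: x; b]) = 0.
Proof.
move=> mA; apply/ffunP => c; have := congr1 (@^~ [:: c]) (mA [:: x; y; z]).
rewrite /dhat tlift_word tliftE.
have -> : (dhat_word m)^~ [:: c] = fun w => m w c.
  by apply/funext => w; rewrite dhat_word1.
have fi p a s := finsupp_insert p (a : clmod) s.
have fZ l p a s := finsuppZ l (fi p a s).
rewrite dhat_word3 !pairingD ?pairingZ //; last exact: finsuppD.
rewrite !pairing_insert [X in _ + X]big1 ?addr0; last first.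
  by move=> b _; rewrite m_one ffunE mulr0.
move=> E; rewrite [RHS]ffunE -[RHS]E !ffunE !sum_ffunE.
by congr (_ + _ * _); apply: eq_bigr => b _; rewrite ffunE.
Qed.

Lemma sum_coefZ (l : Lambda) a (F : clbasis -> clmod) :
  \sum_b (l *: clvec a) b *: F b = l *: F a.
Proof.
rewrite (bigD1 a) //= !ffunE eqxx [_ *: 1]mulr1 big1 ?addr0 // => b /negbTE ba.
by rewrite !ffunE ba [_ *: 0]mulr0 scale0r.
Qed.

Lemma Ainf3_scaled x y z l a l' a' : Ainf_equations m ->
    m [:: x; y] = l *: clvec a -> m [:: y; z] = l' *: clvec a' ->
  l *: m [:: a; z] = - ((-1) ^+ odd (sdeg x) *: (l' *: m [:: x; a'])).
Proof.
move=> /(Ainf3 x y z) + mxy myz; rewrite mxy myz !sum_coefZ => /eqP.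
by rewrite addr_eq0 => /eqP.
Qed.

End ThreeLetterWords.

(** * Cyclicity of [m_2] and [m_3] with explicit parity signs *)

Section CyclicRotation.
Variables (R : realType) (K : fieldType).
Local Notation clvec := (clvec R K).
Variables (m : seq clbasis -> clmod R K) (g : clmod R K -> clmod R K -> novikov R K).
Hypothesis gcyc : cyclic_structure m g.

Lemma cyclic2 x y z : g (m [:: x; y]) (clvec z) =
  (-1) ^+ (odd (sdeg x) && odd (sdeg y + sdeg z)) * g (m [:: y; z]) (clvec x).
Proof.
by rewrite gcyc -signr_odd oddM /= !sdegs_cons /sdegs big_nil addn0.
Qed.

Lemma cyclic3 x y z t : g (m [:: x; y; z]) (clvec t) =
  (-1) ^+ (odd (sdeg x) && odd (sdeg y + (sdeg z + sdeg t)))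
    * g (m [:: y; z; t]) (clvec x).
Proof.
by rewrite gcyc -signr_odd oddM /= !sdegs_cons /sdegs big_nil addn0.
Qed.

End CyclicRotation.

(** * Products and pairings in the Clifford torus model *)

Section CliffordTorus.
Variables (R : realType) (K : fieldType) (sqrt2 : K).
Local Notation Lambda := (novikov R K).
Local Notation clmod := (clmod R K).
Local Notation clvec := (clvec R K).
Local Notation T := (nov_T R K).
Variables (m : seq clbasis -> clmod) (g : clmod -> clmod -> Lambda).
Hypothesis charK : [pchar K] =i pred0.
Hypothesis sqrt2E : sqrt2 ^+ 2 = 2.
Hypothesis hA : clifford_torus_model sqrt2 m g.

Let gbil := ct_bilinear hA.
Let gcyc := ct_cyclic hA.
Let gskew := ct_skew hA.

Lemma nov_nat_neq0 n : (n.+1%:R : Lambda) != 0.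
Proof. by rewrite ((pcharf0P _).1 (nov_pchar R charK)). Qed.

Lemma nov_eqN (x : Lambda) : x = - x -> x = 0.
Proof.
move=> /eqP; rewrite -addr_eq0 -mulr2n -mulr_natl mulf_eq0.
by rewrite (negbTE (nov_nat_neq0 1)) => /eqP.
Qed.

(** Rotating [m_2(f_1, f_2)] against [f_1] gives [m_2(f_2, f_1)] against [f_1], so the value equals
    its own negative. The next lemma needs two rotations. *)
Lemma form_f12_f1 : g (clvec Cf12) (clvec Cf1) = 0.
Proof.
apply: nov_eqN; rewrite -{1}(ct_m2_12 hA) (cyclic2 gcyc) /= expr0 mul1r.
by rewrite (ct_m2_21 hA) bilinNl.
Qed.

Lemma form_f12_f2 : g (clvec Cf12) (clvec Cf2) = 0.
Proof.
apply: nov_eqN; rewrite -{2}(ct_m2_12 hA) (cyclic2 gcyc) /= expr0 mul1r.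
by rewrite (cyclic2 gcyc) /= expr0 mul1r (ct_m2_21 hA) bilinNl // opprK.
Qed.

Lemma T_neq0 : T != 0.
Proof.
apply/eqP => /(congr1 (fun a : Lambda => a 1)) /=; rewrite eqxx.
exact/eqP/oner_neq0.
Qed.

(** One rotation turns the vanishing pairing of [f_12] with [f_2] into that of [m_2(f_2, f_2)], a
    nonzero multiple of [e], with [f_1]. *)
Lemma form_e_f1 : g (clvec Ce) (clvec Cf1) = 0.
Proof.
have := form_f12_f2; rewrite -(ct_m2_12 hA) (cyclic2 gcyc) /= expr0 mul1r.
rewrite (ct_m2_22 hA) bilinZl // => /eqP; rewrite !mulf_eq0 invr_eq0 oner_eq0.
by rewrite (negbTE T_neq0) (negbTE (nov_nat_neq0 1)) => /eqP.
Qed.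

Lemma form_e_f2 : g (clvec Ce) (clvec Cf2) = 0.
Proof.
have := form_f12_f1; rewrite -(ct_m2_12 hA) (cyclic2 gcyc) /= expr0 mul1r.
rewrite (cyclic2 gcyc) /= expr0 mul1r.
rewrite (ct_m2_11 hA) bilinZl // => /eqP; rewrite !mulf_eq0 invr_eq0.
by rewrite (negbTE T_neq0) (negbTE (nov_nat_neq0 1)) (negbTE (nov_nat_neq0 2)) => /eqP.
Qed.

(* The model does not assume that [g] respects the grading; cyclicity on the
   words [f_1 f_2 f_1] and [f_1 f_2 f_2] forces it. *)
Lemma form_even a b : odd (sdeg a + sdeg b) -> g (clvec a) (clvec b) = 0.
Proof.
(* By skew-symmetry [a] may be taken to be [e] or [f_12], and then [b] is [f_1] or [f_2]. *)
wlog: a b / odd (sdeg a) => [H|].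
  have [oa|ea] := boolP (odd (sdeg a)); first exact: H.
  rewrite oddD (negbTE ea) addFb => ob.
  by rewrite gskew H ?mulr0 // oddD ob (negbTE ea).
case: a b => [] [] // _ _.
- exact: form_e_f1.
- exact: form_e_f2.
- exact: form_f12_f1.
- exact: form_f12_f2.
Qed.

Lemma m2_ex x : m [:: Ce; x] = clvec x.
Proof. by case: (ct_unit hA) => /(_ x)[]. Qed.

Lemma m2_xe x : m [:: x; Ce] = (-1) ^+ cldeg x *: clvec x.
Proof.
by case: (ct_unit hA) => /(_ x)[_ <-] _; rewrite scalerA -expr2 sqrr_sign scale1r.
Qed.

Lemma m2_12 : m [:: Cf1; Cf2] = 1 *: clvec Cf12.
Proof. by rewrite (ct_m2_12 hA) scale1r. Qed.

Lemma m2_21 : m [:: Cf2; Cf1] = -1 *: clvec Cf12.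
Proof. by rewrite (ct_m2_21 hA) scaleN1r. Qed.

Let mAinf3 x y z l a l' a' :=
  @Ainf3_scaled R K m (ct_m0 hA) (ct_m1 hA) x y z l a l' a' (ct_Ainf hA).

(** This and the next three products come from the A-infinity equation on [f_1 f_1 f_2],
    [f_2 f_1 f_1], [f_1 f_2 f_2] and [f_2 f_1 f_2] in turn. *)
Lemma m2_1_12 : m [:: Cf1; Cf12] = (- (3 / 2 * T)) *: clvec Cf2.
Proof.
have := mAinf3 (ct_m2_11 hA) m2_12; rewrite m2_ex /= scaleNr => ->.
by rewrite !scale1r opprK.
Qed.

Lemma m2_12_1 : m [:: Cf12; Cf1] = (- (3 / 2 * T)) *: clvec Cf2.
Proof.
have := mAinf3 m2_21 (ct_m2_11 hA); rewrite m2_xe /= !scaleN1r => /oppr_inj ->.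
by rewrite scale1r scalerN scaleNr.
Qed.

Lemma m2_12_2 : m [:: Cf12; Cf2] = (1 / 2 * T) *: clvec Cf1.
Proof.
have := mAinf3 m2_12 (ct_m2_22 hA); rewrite m2_xe /= scaleN1r !scale1r => ->.
by rewrite scalerN opprK.
Qed.

Lemma m2_2_12 : m [:: Cf2; Cf12] = (1 / 2 * T) *: clvec Cf1.
Proof.
have := mAinf3 m2_21 m2_12; rewrite m2_12_2 /= scaleN1r !scale1r.
by move=> /oppr_inj.
Qed.

Lemma m3_e x y z : Ce \in [:: x; y; z] -> m [:: x; y; z] = 0.
Proof. by move=> xyz; have [_ ->] := ct_unit hA. Qed.

Lemma form_m3 x y z : cldeg x = 1%N -> cldeg y = 1%N -> cldeg z = 1%N ->
  g (m [:: x; y; z]) (clvec Cf12) = nov_mono (m3_coef sqrt2 [:: x; y; z]) 1.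
Proof.
by move=> dx dy dz; rewrite (ct_m3 hA) // bilinZl // (ct_pair_ef12 hA) mulr1.
Qed.

(** Here the coefficient 3 of the cycle is forced: squaring the intersection numbers,
    [f_1^2 + 3 f_2^2] equals 2 for each of the three discs, and the three boundaries add up to zero
    against [x]. *)
Lemma m3_coef_sum x : cldeg x = 1%N ->
  m3_coef sqrt2 [:: x; Cf1; Cf1] + 3 * m3_coef sqrt2 [:: x; Cf2; Cf2] = 0.
Proof.
have neq0 n : (n.+1%:R : K) != 0 by rewrite ((pcharf0P _).1 charK).
have s0 : sqrt2 != 0.
  by apply: contra_neq (neq0 1) => s0; rewrite -sqrt2E s0 expr0n.
have fact3 : (3`!%:R : K) != 0 by apply: (neq0 5%N).
case: x => // _; rewrite /m3_coef !big_ord_recr !big_ord0 !big_cons !big_nil;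
  rewrite /disc_cap /disc_boundary /=; field; exact/andP.
Qed.

Lemma m3_coef_perm u v : perm_eq u v -> m3_coef sqrt2 u = m3_coef sqrt2 v.
Proof.
by move=> uv; congr (_ * _); apply: eq_bigr => j _; apply: perm_big.
Qed.

(** Rotation brings [f_12] into the pairing slot, where [form_m3] applies. All signs are trivial
    since [f_1] and [f_2] have even shifted degree, and [m3_coef] is symmetric in its letters. *)
Lemma m3_f_rotations x y : cldeg x = 1%N -> cldeg y = 1%N ->
  let c := nov_mono (m3_coef sqrt2 [:: y; x; x]) 1 in
  [/\ g (m [:: x; x; Cf12]) (clvec y) = c, g (m [:: Cf12; x; x]) (clvec y) = c
    & g (m [:: x; Cf12; x]) (clvec y) = c].
Proof.
move=> dx dy c.
have rot_f a u v w : cldeg a = 1%N ->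
    g (m [:: a; u; v]) (clvec w) = g (m [:: u; v; w]) (clvec a).
  by move=> da; rewrite (cyclic3 gcyc) /sdeg da mul1r.
have cE u : perm_eq u [:: y; x; x] -> nov_mono (m3_coef sqrt2 u) 1 = c.
  by move=> /m3_coef_perm ->.
have E12 : g (m [:: Cf12; x; x]) (clvec y) = c.
  rewrite (cyclic3 gcyc) /sdeg dx dy mul1r form_m3 // cE //.
  by apply/permP => P /=; lia.
split=> //; first by rewrite -rot_f // form_m3.
rewrite rot_f // (cyclic3 gcyc) /sdeg dx dy mul1r form_m3 // cE //.
by apply/permP => P /=; lia.
Qed.

(** This is the [m_3] part of the boundary of the cycle. Against degree 1 basis vectors it reduces
    to [m3_coef_sum]; against [e] and [f_12] it vanishes by parity. *)
Lemma m3_cycle_eq0 :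
  m [:: Cf1; Cf1; Cf12] + m [:: Cf12; Cf1; Cf1] + m [:: Cf1; Cf12; Cf1]
  + (3 : Lambda) *:
      (m [:: Cf2; Cf2; Cf12] + m [:: Cf12; Cf2; Cf2] + m [:: Cf2; Cf12; Cf2])
  = 0.
Proof.
apply: (ct_nondegenerate hA) => y; rewrite bilinEr // big1 // => b _.
rewrite !(bilinDl, bilinZl) //.
have [db|db] := eqVneq (cldeg b) 1%N; last first.
  rewrite !(bilin_m_odd gbil (ct_degree hA) form_even) ?addr0 ?mulr0 ?addr0 ?mulr0 //;
    by rewrite !sdegs_cons /sdegs big_nil; case: b db.
have [-> -> ->] := @m3_f_rotations Cf1 b erefl db.
have [-> -> ->] := @m3_f_rotations Cf2 b erefl db.
have E : nov_mono (m3_coef sqrt2 [:: b; Cf1; Cf1]) 1 =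
    - (3 * nov_mono (m3_coef sqrt2 [:: b; Cf2; Cf2]) 1) :> Lambda.
  apply: nov_ext => l; rewrite nov_coefN mulr_natl !mulrS mulr0n addr0 !nov_coefD.
  rewrite !nov_coef_mono; case: ifP => _; last by rewrite !addr0 oppr0.
  by apply/eqP; rewrite -addr_eq0 -(m3_coef_sum db); apply/eqP; ring.
by rewrite E; ring.
Qed.

End CliffordTorus.

(** * The cycle and its value under [m^+] *)

Theorem proposition5p1 (R : realType) (K : fieldType)
    (charK : [pchar K] =i pred0) (sqrt2 : K) (sqrt2E : sqrt2 ^+ 2 = 2)
    (m : seq clbasis -> clmod R K)
    (g : clmod R K -> clmod R K -> novikov R K)
    (hA : clifford_torus_model sqrt2 m g) :
  let alpha :=
    cyc_norm R K [:: Cf1; Cf1; Cf12] + 3 *: cyc_norm R K [:: Cf2; Cf2; Cf12]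
    + (3 * nov_T R K) *: cyc_norm R K [:: Ce; Cf1; Cf2] in
  nontrivial_cyclic_cycle m alpha /\ mplus m g alpha = 18 * nov_T R K.
Proof.
move=> alpha; set T := nov_T R K in alpha *.
have two0 : (2 : novikov R K) != 0 := nov_nat_neq0 R charK 1.
(* All rotations carry the sign +1, since each word has a single letter of odd shifted degree. *)
pose L : seq (novikov R K * seq clbasis) :=
  [:: (1, [:: Cf1; Cf1; Cf12]); (1, [:: Cf12; Cf1; Cf1]); (1, [:: Cf1; Cf12; Cf1]);
      (3, [:: Cf2; Cf2; Cf12]); (3, [:: Cf12; Cf2; Cf2]); (3, [:: Cf2; Cf12; Cf2]);
      (3 * T, [:: Ce; Cf1; Cf2]); (3 * T, [:: Cf2; Ce; Cf1]);
      (3 * T, [:: Cf1; Cf2; Ce])].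
have alphaE : alpha = \sum_(p <- L) p.1 *: word R K p.2.
  rewrite /alpha !cyc_norm3 /L !big_cons !big_nil !addr0 /= expr0 mulr1.
  apply/funext => v; rewrite !(tensorD, tensorZ); ring.
have alphaf : finsupp alpha by rewrite alphaE; apply: finsupp_words.
have alpha_cyc : cyclic_chain alpha.
  split; first split.
  - by rewrite alphaE /L !big_cons big_nil !tensorD !tensorZ /word /= !mulr0 !addr0.
  - by case: alphaf => s; apply: nov_summable_seq.
  - rewrite alphaE /cyc tlift_words /L !big_cons !big_nil !addr0 !cyc_word3 /= expr0.
    apply/funext => v; rewrite !(tensorD, tensorZ); ring.
(* Rotations contribute equally, and the three orbits give [9/2 T], [9/2 T] and [9 T]. *)
have mplus_alpha : mplus m g alpha = 18 * T.
  rewrite /mplus -/(pairing _ _) alphaE pairing_words /L !big_cons big_nil /=.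
  rewrite (ct_m2_11 hA) (ct_m2_22 hA) (m2_1_12 hA) (m2_12_1 hA) (m2_12_2 hA).
  rewrite (m2_2_12 hA) (m2_12 hA) (m2_ex hA) (m2_xe hA) -/T.
  have gb := ct_bilinear hA; rewrite !bilinZl // /= expr1.
  rewrite (ct_pair_12 hA) (ct_pair_21 hA) (ct_pair_f12e hA) (ct_pair_ef12 hA).
  by field.
have dalpha : dhat m alpha = 0.
  rewrite alphaE /dhat tlift_words /L !big_cons !big_nil !addr0 /=.
  rewrite !(dhat_word3 (ct_m0 hA) (ct_m1 hA)).
  rewrite (ct_m2_11 hA) (ct_m2_22 hA) (m2_1_12 hA) (m2_12_1 hA) (m2_12_2 hA).
  rewrite (m2_2_12 hA) (m2_12 hA) (m2_ex hA) (m2_xe hA) -/T.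
  rewrite [m [:: Ce; _; _]](m3_e hA) // [m [:: _; Ce; _]](m3_e hA) //.
  rewrite [m [:: _; _; Ce]](m3_e hA) //.
  rewrite !insertZ !insert_clvec !insert0 !addr0 /= expr0 !expr1.
  (* The two-letter terms cancel among themselves; the one-letter terms left are those of
     [m3_cycle_eq0]. *)
  have := congr1 (fun a => insert [::] a [::]) (m3_cycle_eq0 charK sqrt2E hA).
  rewrite insert0 !(insertD, insertZ) => m3E; apply/funext => v.
  have := congr1 (@^~ v) m3E; rewrite /= !(tensorD, tensorZ) => E.
  rewrite -[RHS]E; field.
  by [].
split=> //; split=> // -[b b_cyc db].
(* The boundary of [b] is [alpha], which has finite support even when [b] does not. *)
have /eqP : mplus m g alpha = 0.
  rewrite -db; apply: mplus_dhat_eq0 => //; try by case: hA.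
  - exact: form_even hA.
  - by rewrite db.
rewrite mplus_alpha mulf_eq0 (negbTE (nov_nat_neq0 R charK 17)).
by rewrite (negbTE (T_neq0 R K)).
Qed.
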